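(* $\mathsf{RCA}_0$ does not prove the statement: every partial order all of whose initial intervals are finite unions of ideals has no infinite antichains.
   Context: A partial order $(P,\preceq)$ has $P\subseteq\mathbb{N}$. An antichain is a set of pairwise incomparable elements. An initial interval of $P$ is $I\subseteq P$ with $x\preceq y\in I\Rightarrow x\in I$. An ideal is an initial interval $A$ such that for all $x,y\in A$ there is $z\in A$ with $x\preceq z$ and $y\preceq z$. *)

(* Defs.v *)
(* The language L_2 of second-order arithmetic, a classical
   two-sorted natural deduction calculus with equality, the theory RCA_0, and
   the formal sentence about partial orders.
   Variables are de Bruijn indices; number variables and set variables are
   indexed independently, so a number quantifier does not shift set variables,
   nor a set quantifier number variables. *)
From Stdlib Require Import List Arith.
Import ListNotations.

Inductive term : Type :=
| Var  : nat -> term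
| Zero : term
| One  : term
| TAdd : term -> term -> term
| TMul : term -> term -> term.

Inductive form : Type :=
| Eq   : term -> term -> form
| Lt   : term -> term -> form
| Mem  : term -> nat -> form       (* the second argument is a set variable *)
| Bot  : form
| Imp  : form -> form -> form
| And  : form -> form -> form
| Or   : form -> form -> form
| NAll : form -> form
| NEx  : form -> form
| SAll : form -> form
| SEx  : form -> form.

Declare Scope L2_scope.
Delimit Scope L2_scope with L2.
Bind Scope L2_scope with term form.

Notation "# n" := (Var n) (at level 1, format "# n") : L2_scope.
Notation "s + t" := (TAdd s t) : L2_scope.
Notation "s * t" := (TMul s t) : L2_scope.
Notation "s == t" := (Eq s t) (at level 70) : L2_scope.
Notation "s < t" := (Lt s t) : L2_scope.
Notation "t 'IN' X" := (Mem t X) (at level 70, X at level 9) : L2_scope.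
Notation "a --> b" := (Imp a b) (at level 90, right associativity) : L2_scope.
Notation "a /\ b" := (And a b) : L2_scope.
Notation "a \/ b" := (Or a b) : L2_scope.
Notation "a <--> b" := (And (Imp a b) (Imp b a)) (at level 91) : L2_scope.
Notation "~ a" := (Imp a Bot) : L2_scope.

Fixpoint tsubst (s : nat -> term) (t : term) : term :=
  match t with
  | Var n => s n
  | Zero => Zero
  | One => One
  | TAdd a b => TAdd (tsubst s a) (tsubst s b)
  | TMul a b => TMul (tsubst s a) (tsubst s b)
  end.

Definition tshift : term -> term := tsubst (fun n => Var (S n)).

Definition scons {A : Type} (a : A) (f : nat -> A) (n : nat) : A :=
  match n with 0 => a | S m => f m end.

Definition nup (s : nat -> term) : nat -> term :=
  scons (Var 0) (fun n => tshift (s n)).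

Definition sup (r : nat -> nat) : nat -> nat :=
  scons 0 (fun n => S (r n)).

Fixpoint fsubst (s : nat -> term) (r : nat -> nat) (f : form) : form :=
  match f with
  | Eq a b => Eq (tsubst s a) (tsubst s b)
  | Lt a b => Lt (tsubst s a) (tsubst s b)
  | Mem a X => Mem (tsubst s a) (r X)
  | Bot => Bot
  | Imp f g => Imp (fsubst s r f) (fsubst s r g)
  | And f g => And (fsubst s r f) (fsubst s r g)
  | Or f g => Or (fsubst s r f) (fsubst s r g)
  | NAll f => NAll (fsubst (nup s) r f)
  | NEx f => NEx (fsubst (nup s) r f)
  | SAll f => SAll (fsubst s (sup r) f)
  | SEx f => SEx (fsubst s (sup r) f)
  end.

Definition ninst (t : term) : form -> form := fsubst (scons t Var) (fun X => X).
Definition sinst (X : nat) : form -> form := fsubst Var (scons X (fun Y => Y)).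
Definition nshift : form -> form := fsubst (fun n => Var (S n)) (fun X => X).
Definition sshift : form -> form := fsubst Var S.

Inductive prv : list form -> form -> Prop :=
| P_Hyp   G f : In f G -> prv G f
| P_ImpI  G f g : prv (f :: G) g -> prv G (Imp f g)
| P_ImpE  G f g : prv G (Imp f g) -> prv G f -> prv G g
| P_AndI  G f g : prv G f -> prv G g -> prv G (And f g)
| P_AndE1 G f g : prv G (And f g) -> prv G f
| P_AndE2 G f g : prv G (And f g) -> prv G g
| P_OrI1  G f g : prv G f -> prv G (Or f g)
| P_OrI2  G f g : prv G g -> prv G (Or f g)
| P_OrE   G f g h :
    prv G (Or f g) -> prv (f :: G) h -> prv (g :: G) h -> prv G h
| P_Raa   G f : prv (Imp f Bot :: G) Bot -> prv G f
| P_NAllI G f : prv (map nshift G) f -> prv G (NAll f)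
| P_NAllE G f t : prv G (NAll f) -> prv G (ninst t f)
| P_NExI  G f t : prv G (ninst t f) -> prv G (NEx f)
| P_NExE  G f g :
    prv G (NEx f) -> prv (f :: map nshift G) (nshift g) -> prv G g
| P_SAllI G f : prv (map sshift G) f -> prv G (SAll f)
| P_SAllE G f X : prv G (SAll f) -> prv G (sinst X f)
| P_SExI  G f X : prv G (sinst X f) -> prv G (SEx f)
| P_SExE  G f g :
    prv G (SEx f) -> prv (f :: map sshift G) (sshift g) -> prv G g
| P_EqI   G t : prv G (Eq t t)
| P_EqE   G s t f : prv G (Eq s t) -> prv G (ninst s f) -> prv G (ninst t f).

Definition proves (T : form -> Prop) (f : form) : Prop :=
  exists G : list form, (forall a, In a G -> T a) /\ prv G f.

Fixpoint tbound (t : term) : nat :=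
  match t with
  | Var n => S n
  | Zero | One => 0
  | TAdd a b | TMul a b => Nat.max (tbound a) (tbound b)
  end.

(* [nbound f] and [sbound f] are the least n such that every free number
   (resp. set) variable of f is < n. *)
Fixpoint nbound (f : form) : nat :=
  match f with
  | Eq a b | Lt a b => Nat.max (tbound a) (tbound b)
  | Mem a _ => tbound a
  | Bot => 0
  | Imp f g | And f g | Or f g => Nat.max (nbound f) (nbound g)
  | NAll f | NEx f => Nat.pred (nbound f)
  | SAll f | SEx f => nbound f
  end.

Fixpoint sbound (f : form) : nat :=
  match f with
  | Eq _ _ | Lt _ _ | Bot => 0
  | Mem _ X => S X
  | Imp f g | And f g | Or f g => Nat.max (sbound f) (sbound g)
  | NAll f | NEx f => sbound f
  | SAll f | SEx f => Nat.pred (sbound f)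
  end.

Definition closure (f : form) : form :=
  Nat.iter (sbound f) SAll (Nat.iter (nbound f) NAll f).

(* [tshift t]: the bound of a bounded quantifier does not contain the
   quantified variable.  Set variables may occur as parameters. *)
Definition ball (t : term) (f : form) : form := NAll (Imp (Lt (Var 0) (tshift t)) f).
Definition bex (t : term) (f : form) : form := NEx (And (Lt (Var 0) (tshift t)) f).

Inductive bounded : form -> Prop :=
| B_Eq s t : bounded (Eq s t)
| B_Lt s t : bounded (Lt s t)
| B_Mem t X : bounded (Mem t X)
| B_Bot : bounded Bot
| B_Imp f g : bounded f -> bounded g -> bounded (Imp f g)
| B_And f g : bounded f -> bounded g -> bounded (And f g)
| B_Or f g : bounded f -> bounded g -> bounded (Or f g)
| B_All t f : bounded f -> bounded (ball t f)
| B_Ex t f : bounded f -> bounded (bex t f).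

Inductive Sigma01 : form -> Prop :=
| Sigma01_intro f : bounded f -> Sigma01 (NEx f).

Inductive Pi01 : form -> Prop :=
| Pi01_intro f : bounded f -> Pi01 (NAll f).

(* Here #1 is m and #0 is n. *)
Definition basic_axioms : list form :=
  [ ~ (#0 + One == Zero);
    #1 + One == #0 + One --> #1 == #0;
    #1 + Zero == #1;
    #1 + (#0 + One) == (#1 + #0) + One;
    #1 * Zero == Zero;
    #1 * (#0 + One) == (#1 * #0) + #1;
    ~ (#1 < Zero);
    #1 < #0 + One <--> (#1 < #0 \/ #1 == #0) ]%L2.

(* The induction variable is #0. *)
Definition induction (f : form) : form :=
  (ninst Zero f
   /\ NAll (f --> fsubst (scons (#0 + One) (fun n => #(S n))) (fun X => X) f)
   --> NAll f)%L2.

(* The comprehension variable is #0; [sshift] keeps the new set out of f. *)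
Definition delta_comprehension (f g : form) : form :=
  (NAll (f <--> g) --> SEx (NAll (#0 IN 0 <--> sshift f)))%L2.

Inductive RCA0 : form -> Prop :=
| RCA0_basic_ax f : In f basic_axioms -> RCA0 (closure f)
| RCA0_ind_ax f : Sigma01 f -> RCA0 (closure (induction f))
| RCA0_comp_ax f g :
    Sigma01 f -> Pi01 g -> RCA0 (closure (delta_comprehension f g)).

(* The usual pairing of second-order arithmetic, (i,j) = (i+j)^2 + i. *)
Definition code (i j : term) : term := ((i + j) * (i + j) + i)%L2.

(* The arguments P, R, I, A, D, Z below are set variables; R is the set of
   codes of the pairs (x,y) such that x precedes y. *)
Definition below (R : nat) (x y : term) : form := (code x y IN R)%L2.

Definition subset (X Y : nat) : form := NAll (#0 IN X --> #0 IN Y)%L2.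

Definition partial_order (P R : nat) : form :=
  (NAll (#0 IN R --> NEx (NEx (#1 IN P /\ #0 IN P /\ #2 == code #1 #0)))
   /\ NAll (#0 IN P --> below R #0 #0)
   /\ NAll (NAll (below R #1 #0 --> below R #0 #1 --> #1 == #0))
   /\ NAll (NAll (NAll (below R #2 #1 --> below R #1 #0 --> below R #2 #0))))%L2.

Definition initial_interval (P R I : nat) : form :=
  (subset I P
   /\ NAll (NAll (below R #1 #0 --> #0 IN I --> #1 IN I)))%L2.

Definition ideal (P R A : nat) : form :=
  (initial_interval P R A
   /\ NAll (NAll (#1 IN A --> #0 IN A -->
        NEx (#0 IN A /\ below R #2 #0 /\ below R #1 #0))))%L2.

(* A = (Z)_i, the i-th set of the sequence of sets coded by Z. *)
Definition is_section (Z : nat) (i : term) (A : nat) : form :=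
  NAll (#0 IN A <--> code #0 (tshift i) IN Z)%L2.

(* There are k and Z such that (Z)_0, ..., (Z)_(k-1) are ideals with union I. *)
Definition finite_union_of_ideals (P R I : nat) : form :=
  NEx (SEx
    (ball #0 (SEx (is_section 1 #0 0 /\ ideal (S (S P)) (S (S R)) 0))
     /\ NAll (#0 IN (S I) <--> bex #1 (code #1 #0 IN 0))))%L2.

Definition infinite (D : nat) : form := NAll (NEx (#1 < #0 /\ #0 IN D))%L2.

Definition antichain (P R D : nat) : form :=
  (subset D P
   /\ NAll (NAll (#1 IN D --> #0 IN D --> ~ (#1 == #0) -->
        ~ (below R #1 #0) /\ ~ (below R #0 #1))))%L2.

(* The set variables P and R are 1 and 0, and 2 and 1 below a further set
   quantifier. *)
Definition finite_unions_imply_no_infinite_antichain : form :=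
  SAll (SAll
    (partial_order 1 0
     /\ SAll (initial_interval 2 1 0 --> finite_union_of_ideals 2 1 0)
     --> ~ SEx (antichain 2 1 0 /\ infinite 0)))%L2.

(* Main.v *)
From Stdlib Require Import List Arith Lia Cantor.
From Stdlib Require Import Classical ClassicalEpsilon FunctionalExtensionality.
Require Import Defs.

(* We build a partial order R on nat, with the even numbers as an antichain,
   such that the omega-model of all sets Delta_1 in R refutes the sentence.
   R is obtained by forcing.  A condition is an order with a cut n: all
   elements z >= n have the same type over [0,n).  Given a pair of Sigma_1
   definitions of a set I and of its complement, look at the element x = n.
   If some extension leaving x incomparable with n+1, n+2, ... forces x in I,
   take a finite part of it and put x above all later elements; if some such
   extension forces x notin I, put x below all later elements; otherwise leave
   x alone, and then neither definition ever applies to x.  Hence if I is an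
   initial interval in the model, either it contains a single x above almost
   all elements or it is finite, so it is a finite union of principal ideals.
   As R only has to be generic, not computable, no coding of syntax inside
   arithmetic is needed. *)

(** * Finite approximations of partial orders *)

Definition rel := nat -> nat -> Prop.

(** The infinite antichain is fixed in advance as the even numbers, so that it lies in the model
    whatever the generic relation is; only odd elements are ever committed. *)
Record even_antichain_order (R : rel) : Prop := {
  po_refl a : R a a;
  po_antisym a b : R a b -> R b a -> a = b;
  po_trans a b c : R a b -> R b c -> R a c;
  po_even a b : Nat.Even a -> Nat.Even b -> R a b -> a = b }.

Definition cut (R : rel) (n : nat) : Prop :=
  forall a z, a < n -> n <= z -> (R a z <-> R a n) /\ (R z a <-> R n a).

Definition agree (n : nat) (R R' : rel) : Prop :=
  forall a b, a < n -> b < n -> (R a b <-> R' a b).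

(** Agreement includes [n] itself, since the row of [n] records the type over [[0,n)] that the cut
    prescribes for every later element. *)
Definition extends (n : nat) (R R' : rel) : Prop :=
  agree (S n) R R' /\ cut R' n.

(** The cut at [S n] spreads the incomparability of [n] with [S n] to all later elements. *)
Definition uncommitted (n : nat) (R : rel) : Prop :=
  cut R n /\ cut R (S n) /\ ~ R n (S n) /\ ~ R (S n) n.

Definition flip_rel (R : rel) : rel := fun a b => R b a.

Lemma flip_order R : even_antichain_order R -> even_antichain_order (flip_rel R).
Proof.
  intros [r a t e]; split; unfold flip_rel; eauto.
  intros x y Hx Hy H; symmetry; eauto.
Qed.

Lemma flip_cut R n : cut R n -> cut (flip_rel R) n.
Proof. intros H a z Ha Hz; destruct (H a z Ha Hz); split; assumption. Qed.

Lemma flip_agree n R R' : agree n R R' -> agree n (flip_rel R) (flip_rel R').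
Proof. intros H a b Ha Hb; exact (H b a Hb Ha). Qed.

Lemma agree_trans n R S T : agree n R S -> agree n S T -> agree n R T.
Proof. intros H K a b Ha Hb; rewrite (H a b Ha Hb); exact (K a b Ha Hb). Qed.

Lemma agree_le m n R R' : m <= n -> agree n R R' -> agree m R R'.
Proof. intros L H a b Ha Hb; apply H; lia. Qed.

(** A point up to [n] is covered by the agreement with [R]; a later one is first moved to [n] by the
    cut of [R'] at [n]. *)
Lemma cut_extends n c R R' : c <= n -> cut R c -> extends n R R' -> cut R' c.
Proof.
  intros L H [A C] a z Ha Hz.
  rewrite <- (A a c), <- (A c a) by lia.
  destruct (le_lt_dec z n) as [Hzn|Hzn].
  - rewrite <- (A a z), <- (A z a) by lia. apply H; lia.
  - destruct (C a z) as [-> ->]; try lia.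
    rewrite <- (A a n), <- (A n a) by lia. apply H; lia.
Qed.

Lemma extends_trans n m R S T :
  n <= m -> extends n R S -> extends m S T -> extends n R T.
Proof.
  intros L [A C] E; split.
  - eapply agree_trans; [exact A|]. eapply agree_le; [|exact (proj1 E)]. lia.
  - eapply cut_extends; [exact L|exact C|exact E].
Qed.

Lemma uncommitted_extends n m R R' :
  n < m -> uncommitted n R -> extends m R R' -> uncommitted n R'.
Proof.
  intros L (C & C' & H & H') E.
  assert (A := proj1 E).
  split; [|split; [|split]].
  - apply (cut_extends m n R); [lia|assumption|assumption].
  - apply (cut_extends m (S n) R); [lia|assumption|assumption].
  - rewrite <- (A n (S n)) by lia; assumption.
  - rewrite <- (A (S n) n) by lia; assumption.
Qed.

(* From [m] on, new elements keep the type over [0,n) prescribed by the cut,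
   lie below [n], and are otherwise incomparable with everything; whatever
   commitments [R] made to elements between [n] and [m] are forgotten. *)
Lemma commit_above R n m :
  even_antichain_order R -> Nat.Odd n -> uncommitted n R -> S n < m ->
  exists R', even_antichain_order R' /\ agree m R R' /\ cut R' n /\ cut R' m /\ R' m n.
Proof.
  intros [r a t e] On (Cn & Cn' & N1 & N2) Hm.
  (* [S n] is an even element of the type over [[0,n)] that new elements receive, so an even element
     below [n] comparable with a new one would be comparable with [S n]. *)
  assert (Even_Sn : Nat.Even (S n)) by (apply Nat.Even_succ; assumption).
  assert (Hodd : forall x, x = n -> Nat.Even x -> False).
  { intros x -> Ex. exact (Nat.Even_Odd_False _ Ex On). }
  assert (dn : forall x y, x < n -> n <= y -> R x y -> R x n).
  { intros x y Hx Hy H. apply (Cn x y Hx Hy); exact H. }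
  assert (up : forall x y, x < n -> n <= y -> R y x -> R n x).
  { intros x y Hx Hy H. apply (Cn x y Hx Hy); exact H. }
  assert (dn' : forall x y, x < n -> n <= y -> R x n -> R x y).
  { intros x y Hx Hy H. apply (Cn x y Hx Hy); exact H. }
  assert (up' : forall x y, x < n -> n <= y -> R n x -> R y x).
  { intros x y Hx Hy H. apply (Cn x y Hx Hy); exact H. }
  assert (top : forall y, n < y -> ~ R n y).
  { intros y Hy H. apply N1, (Cn' n y); [lia|lia|exact H]. }
  exists (fun x y =>
    (x < m /\ y < m /\ R x y) \/
    (x < n /\ m <= y /\ R x n) \/
    (m <= x /\ y <= n /\ R n y) \/
    (m <= x /\ x = y)).
  split; [split|split; [|split; [|split]]].
  - intros x. destruct (le_lt_dec m x); auto 6.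
  - intros x y Hxy Hyx.
    destruct Hxy as [(? & ? & ?)|[(? & ? & ?)|[(? & ? & ?)|(? & ?)]]];
    destruct Hyx as [(? & ? & ?)|[(? & ? & ?)|[(? & ? & ?)|(? & ?)]]];
    try lia; eauto.
    + assert (x = n) by eauto. lia.
    + assert (y = n) by eauto. lia.
  - intros x y z Hxy Hyz.
    destruct Hxy as [(? & ? & ?)|[(? & ? & ?)|[(? & ? & Hny)|(? & ?)]]];
    destruct Hyz as [(? & ? & Hyz)|[(? & ? & ?)|[(? & ? & ?)|(? & ?)]]];
    subst; try lia; eauto 8.
    (* If [n <= x], the cut turns [R x y] into [R n y]; with [R y n] this gives [y = n], contrary to
       [y < n]. *)
    + right; left. destruct (le_lt_dec n x) as [L|L]; [|eauto].
      assert (y = n) by eauto. lia.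
    + left. repeat split; try lia; eauto.
    (* Here [R n z] holds by transitivity, and [top] forbids [z] to come after [n]. *)
    + right; right; left. repeat split; eauto.
      destruct (le_lt_dec z n); [assumption|]. exfalso. apply (top z); eauto.
    + assert (y = n) by eauto. lia.
  - intros x y Ex Ey Hxy.
    destruct Hxy as [(? & ? & ?)|[(? & ? & ?)|[(? & ? & ?)|(? & ?)]]]; eauto.
    + assert (x = S n) by (apply e; auto). lia.
    + destruct (Nat.eq_dec y n) as [Hy|Hy]; [destruct (Hodd y Hy Ey)|].
      assert (S n = y); [|lia]. apply e; auto. apply up'; auto; lia.
  - intros x y Hx Hy. split; [auto|].
    intros [(? & ? & ?)|[(? & ? & ?)|[(? & ? & ?)|(? & ?)]]]; try lia; auto.
  - intros x z Hx Hz.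
    destruct (le_lt_dec m z); split; split;
    (intros [(? & ? & ?)|[(? & ? & ?)|[(? & ? & ?)|(? & ?)]]]; try lia);
    first [ left; repeat split; eauto; lia
          | right; left; repeat split; eauto; lia
          | right; right; left; repeat split; eauto; lia ].
  - intros x z Hx Hz. split; split;
    (intros [(? & ? & ?)|[(? & ? & ?)|[(? & ? & ?)|(? & ?)]]]; try lia);
    first [ left; repeat split; eauto; lia
          | right; left; repeat split; eauto; lia
          | right; right; left; repeat split; eauto; lia ].
  - right; right; left. repeat split; [lia|lia|apply r].
Qed.

(** Dual to [commit_above]: reversing the order preserves the antichain, cuts and agreement. *)
Lemma commit_below R n m :
  even_antichain_order R -> Nat.Odd n -> uncommitted n R -> S n < m ->
  exists R', even_antichain_order R' /\ agree m R R' /\ cut R' n /\ cut R' m /\ R' n m.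
Proof.
  intros G On (C & C' & H & H') Hm.
  destruct (commit_above (flip_rel R) n m) as (R' & G' & A & K & K' & Z); auto.
  - apply flip_order, G.
  - split; [|split; [|split]]; try apply flip_cut; assumption.
  - exists (flip_rel R'). split; [|split; [|split; [|split]]].
    + apply flip_order, G'.
    + exact (flip_agree _ _ _ A).
    + apply flip_cut, K.
    + apply flip_cut, K'.
    + exact Z.
Qed.

(** From [n] on all elements become pairwise incomparable copies of [n] over [[0,n)], which makes
    every [c >= n] a cut. The cut at [n + 2] keeps the next stage at an odd number. *)
Lemma leave_uncommitted R n :
  even_antichain_order R -> cut R n ->
  exists R', even_antichain_order R' /\ agree (S n) R R' /\ uncommitted n R' /\ cut R' (S (S n)).
Proof.
  intros [r a t e] Cn.
  assert (dn' : forall x y, x < n -> n <= y -> R x n -> R x y).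
  { intros x y Hx Hy H. apply (Cn x y Hx Hy); exact H. }
  assert (up' : forall x y, x < n -> n <= y -> R n x -> R y x).
  { intros x y Hx Hy H. apply (Cn x y Hx Hy); exact H. }
  set (R' := fun x y =>
    (x < n /\ y < n /\ R x y) \/
    (x < n /\ n <= y /\ R x n) \/
    (n <= x /\ y < n /\ R n y) \/
    (n <= x /\ x = y)).
  assert (K : forall c, n <= c -> cut R' c).
  { intros c Hc x z Hx Hz. unfold R'. split; split;
    (intros [(? & ? & ?)|[(? & ? & ?)|[(? & ? & ?)|(? & ?)]]]; try lia);
    first [ left; repeat split; eauto; lia
          | right; left; repeat split; eauto; lia
          | right; right; left; repeat split; eauto; lia ]. }
  exists R'. split; [split|split; [|split; [|apply K; lia]]].
  - intros x. unfold R'. destruct (le_lt_dec n x); auto 6.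
  - intros x y Hxy Hyx. unfold R' in *.
    destruct Hxy as [(? & ? & ?)|[(? & ? & ?)|[(? & ? & ?)|(? & ?)]]];
    destruct Hyx as [(? & ? & ?)|[(? & ? & ?)|[(? & ? & ?)|(? & ?)]]];
    try lia; eauto.
  - intros x y z Hxy Hyz. unfold R' in *.
    destruct Hxy as [(? & ? & ?)|[(? & ? & ?)|[(? & ? & ?)|(? & ?)]]];
    destruct Hyz as [(? & ? & ?)|[(? & ? & ?)|[(? & ? & ?)|(? & ?)]]];
    subst; try lia; eauto 10.
    assert (y = n) by eauto. lia.
  - intros x y Ex Ey Hxy. unfold R' in Hxy.
    destruct Hxy as [(? & ? & ?)|[(? & ? & ?)|[(? & ? & ?)|(? & ?)]]]; eauto.
  - intros x y Hx Hy. unfold R'.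
    destruct (Nat.eq_dec x n) as [->|]; destruct (Nat.eq_dec y n) as [->|].
    + split; auto.
    + split; [intros; right; right; left; repeat split; auto; lia|].
      intros [(? & ? & ?)|[(? & ? & ?)|[(? & ? & ?)|(? & ?)]]]; try lia; auto.
    + split; [intros; right; left; repeat split; auto; lia|].
      intros [(? & ? & ?)|[(? & ? & ?)|[(? & ? & ?)|(? & ?)]]]; try lia; auto.
    + split; [intros; left; repeat split; auto; lia|].
      intros [(? & ? & ?)|[(? & ? & ?)|[(? & ? & ?)|(? & ?)]]]; try lia; auto.
  - split; [|split; [|split]]; [apply K; lia|apply K; lia| |]; unfold R'; lia.
Qed.

(** * A generic partial order *)

(** Openness in the topology whose basic neighbourhoods fix a relation on [[0,m)]. *)
Definition open_pred (A : rel -> Prop) : Prop :=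
  forall R, A R -> exists m, forall R', agree m R R' -> A R'.

Definition condition (p : nat * rel) : Prop :=
  even_antichain_order (snd p) /\ Nat.Odd (fst p) /\ cut (snd p) (fst p).

(** The commitment concerns only the element [m]; the cut at [m] spreads it to all later ones. The
    third outcome covers every order that extends the old approximation and keeps [n] uncommitted,
    hence also the limit of the construction. *)
Definition decides (A B : nat -> rel -> Prop) (p q : nat * rel) : Prop :=
  let (n, R) := p in let (m, R') := q in
  n < m /\ extends n R R' /\
  ((R' m n /\ forall S, agree m R' S -> A n S) \/
   (R' n m /\ forall S, agree m R' S -> B n S) \/
   (uncommitted n R' /\
    forall S, even_antichain_order S -> agree (Datatypes.S n) R S ->
      uncommitted n S -> ~ A n S /\ ~ B n S)).

Lemma odd_bound n k : exists m, Nat.Odd m /\ n < m /\ k <= m.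
Proof. exists (2 * (n + k) + 1). split; [exists (n + k)|]; lia. Qed.

Lemma decide (A B : nat -> rel -> Prop) p :
  (forall x, open_pred (A x)) -> (forall x, open_pred (B x)) ->
  condition p -> exists q, condition q /\ decides A B p q.
Proof.
  destruct p as [n R]; intros HA HB (G & On & C); simpl in *.
  destruct (classic (exists S, even_antichain_order S /\ agree (Datatypes.S n) R S /\
                       uncommitted n S /\ A n S)) as [(S & GS & AS & US & HS)|NA].
  (* The truth of [A n] at [S] is secured by [S] below [k], so a commitment that changes [S] only
     from some [m >= k] on preserves it. *)
  { destruct (HA n S HS) as [k Hk].
    destruct (odd_bound (Datatypes.S n) k) as (m & Om & Lm & Lk).
    destruct (commit_above S n m GS On US Lm) as (R' & G' & A' & Cn & Cm & Z).
    exists (m, R'). split; [split; [|split]; assumption|].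
    split; [lia|]. split; [split; [|assumption]|].
    - eapply agree_trans; [exact AS|]. eapply agree_le; [|exact A']. lia.
    - left. split; [assumption|]. intros T AT. apply Hk.
      apply (agree_le _ m); [lia|]. exact (agree_trans _ _ _ _ A' AT). }
  destruct (classic (exists S, even_antichain_order S /\ agree (Datatypes.S n) R S /\
                       uncommitted n S /\ B n S)) as [(S & GS & AS & US & HS)|NB].
  { destruct (HB n S HS) as [k Hk].
    destruct (odd_bound (Datatypes.S n) k) as (m & Om & Lm & Lk).
    destruct (commit_below S n m GS On US Lm) as (R' & G' & A' & Cn & Cm & Z).
    exists (m, R'). split; [split; [|split]; assumption|].
    split; [lia|]. split; [split; [|assumption]|].
    - eapply agree_trans; [exact AS|]. eapply agree_le; [|exact A']. lia.
    - right; left. split; [assumption|]. intros T AT. apply Hk.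
      apply (agree_le _ m); [lia|]. exact (agree_trans _ _ _ _ A' AT). }
  destruct (leave_uncommitted R n G C) as (R' & G' & A' & U & Cm).
  exists (Datatypes.S (Datatypes.S n), R').
  split; [split; [|split]; simpl; [assumption| |assumption]|].
  { destruct On as [j ->]. exists (Datatypes.S j). lia. }
  split; [lia|]. split; [split; [assumption|exact (proj1 U)]|].
  right; right. split; [assumption|]. intros S GS AS US. split; intros H.
  - apply NA. eauto.
  - apply NB. eauto.
Qed.

(** One requirement is decided per stage, and the limit inherits the outcome because it extends
    every stage. *)
Lemma generic_order (A B : nat -> nat -> rel -> Prop) :
  (forall e x, open_pred (A e x)) -> (forall e x, open_pred (B e x)) ->
  exists R, even_antichain_order R /\
    forall e, exists x N, x < N /\
      ((A e x R /\ forall z, N <= z -> R z x) \/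
       (B e x R /\ forall z, N <= z -> R x z) \/
       (~ A e x R /\ ~ B e x R)).
Proof.
  intros HA HB.
  (* The implication makes the step total, so that it can be iterated before its values are known to
     be conditions. *)
  assert (step : forall e p, { q | condition p -> condition q /\ decides (A e) (B e) p q }).
  { intros e p. apply constructive_indefinite_description.
    destruct (classic (condition p)) as [V|V].
    - destruct (decide (A e) (B e) p (HA e) (HB e) V) as [q H]. exists q; auto.
    - exists p; intros; contradiction. }
  (* Stage [0] is the discrete order, with its cut at [1] because cuts sit at odd numbers. *)
  set (s := fix s (e : nat) : nat * rel :=
              match e with
              | 0 => (1, eq)
              | S e => proj1_sig (step e (s e))
              end).
  assert (V : forall e, condition (s e)).
  { induction e as [|e IH].
    - split; [split|split]; simpl; try congruence; auto.
      + exists 0; reflexivity.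
      + intros a z Ha Hz. split; split; lia.
    - simpl. destruct (step e (s e)) as [q Hq]; simpl. apply Hq, IH. }
  assert (D : forall e, decides (A e) (B e) (s e) (s (S e))).
  { intros e. simpl. destruct (step e (s e)) as [q Hq]; simpl. apply Hq, V. }
  assert (E : forall e, fst (s e) < fst (s (S e)) /\
                        extends (fst (s e)) (snd (s e)) (snd (s (S e)))).
  { intros e. specialize (D e). destruct (s e), (s (S e)). split; apply D. }
  assert (mono : forall d e, fst (s e) + d <= fst (s (d + e))).
  { induction d as [|d IH]; intros e; [simpl; lia|].
    specialize (IH e). destruct (E (d + e)). simpl plus. lia. }
  assert (big : forall e, e <= fst (s e)).
  { intros e. specialize (mono e 0). rewrite Nat.add_0_r in mono. lia. }
  assert (ext : forall d e, extends (fst (s e)) (snd (s e)) (snd (s (d + e)))).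
  { induction d as [|d IH]; intros e.
    - split; [intros ? ? ? ?; reflexivity|apply V].
    - eapply extends_trans; [|apply IH|apply E]. specialize (mono d e); lia. }
  (* The cut grows at every stage, so stage [a + b] has already fixed the pair [a], [b]. *)
  set (R := fun a b => snd (s (a + b)) a b).
  assert (lim : forall a b e, a <= e -> b <= e -> (R a b <-> snd (s e) a b)).
  { intros a b e Ha Hb. unfold R.
    destruct (Nat.le_ge_cases (a + b) e) as [L|L].
    - destruct (ext (e - (a + b)) (a + b)) as [K _].
      replace (e - (a + b) + (a + b)) with e in K by lia.
      specialize (big (a + b)). apply K; lia.
    - destruct (ext (a + b - e) e) as [K _].
      replace (a + b - e + e) with (a + b) in K by lia.
      specialize (big e). symmetry. apply K; lia. }
  assert (extR : forall e, extends (fst (s e)) (snd (s e)) R).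
  { intros e. split.
    - intros a b Ha Hb. rewrite (lim a b (a + b + e)) by lia.
      apply (proj1 (ext (a + b) e)); lia.
    - intros a z Ha Hz. set (n := fst (s e)) in *.
      rewrite (lim a z (a + z + n + e)), (lim z a (a + z + n + e)),
              (lim a n (a + z + n + e)), (lim n a (a + z + n + e)) by lia.
      apply (proj2 (ext (a + z + n) e)); assumption. }
  assert (G : even_antichain_order R).
  { split.
    - intros a. exact (po_refl _ (proj1 (V (a + a))) a).
    - intros a b H K. rewrite (lim a b (a + b)) in H by lia.
      rewrite (lim b a (a + b)) in K by lia.
      exact (po_antisym _ (proj1 (V _)) _ _ H K).
    - intros a b c H K. rewrite (lim a b (a + b + c)) in H by lia.
      rewrite (lim b c (a + b + c)) in K by lia.
      rewrite (lim a c (a + b + c)) by lia.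
      exact (po_trans _ (proj1 (V _)) _ _ _ H K).
    - intros a b. exact (po_even _ (proj1 (V (a + b))) a b). }
  exists R. split; [exact G|]. intros e.
  assert (De := D e). assert (Ee := extR e). assert (ESe := extR (S e)).
  destruct (s e) as [n Rn], (s (S e)) as [m Rm]. simpl in Ee, ESe.
  destruct De as (L & X & H). exists n, m. split; [assumption|].
  assert (Agm : agree m Rm R) by (apply (agree_le _ (S m)); [lia|apply ESe]).
  destruct H as [[H K]|[[H K]|[U K]]].
  - left. split; [auto|]. intros z Hz. apply (proj2 ESe n z L Hz).
    apply (proj1 ESe); auto; lia.
  - right; left. split; [auto|]. intros z Hz. apply (proj2 ESe n z L Hz).
    apply (proj1 ESe); auto; lia.
  - right; right. apply K; [exact G|apply Ee|].
    apply (uncommitted_extends n m Rm); assumption.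
Qed.

(** * Sigma_1 predicates relative to an oracle *)

Fixpoint teval (v : nat -> nat) (t : term) : nat :=
  match t with
  | Var n => v n
  | Zero => 0
  | One => 1
  | TAdd a b => teval v a + teval v b
  | TMul a b => teval v a * teval v b
  end.

Lemma teval_subst v s t : teval v (tsubst s t) = teval (fun n => teval v (s n)) t.
Proof. induction t; simpl; congruence. Qed.

Lemma teval_shift y v t : teval (scons y v) (tshift t) = teval v t.
Proof. apply teval_subst. Qed.

Lemma teval_scons v t s :
  (fun n => teval v (scons t s n)) = scons (teval v t) (fun n => teval v (s n)).
Proof. apply functional_extensionality; intros [|n]; reflexivity. Qed.

Lemma teval_nup y v s :
  (fun n => teval (scons y v) (nup s n)) = scons y (fun n => teval v (s n)).
Proof.
  apply functional_extensionality; intros [|n]; simpl; [reflexivity|].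
  apply teval_shift.
Qed.

(* Negation is only available on atoms, which keeps truth continuous in the
   oracle; unbounded existential quantifiers may occur anywhere. *)
Inductive sigma : Type :=
| SgEq : term -> term -> sigma
| SgLt : term -> term -> sigma
| SgIn : term -> sigma
| SgNotin : term -> sigma
| SgAnd : sigma -> sigma -> sigma
| SgOr : sigma -> sigma -> sigma
| SgBall : term -> sigma -> sigma
| SgEx : sigma -> sigma.

Fixpoint holds (O : nat -> Prop) (c : sigma) (v : nat -> nat) : Prop :=
  match c with
  | SgEq a b => teval v a = teval v b
  | SgLt a b => teval v a < teval v b
  | SgIn a => O (teval v a)
  | SgNotin a => ~ O (teval v a)
  | SgAnd c d => holds O c v /\ holds O d v
  | SgOr c d => holds O c v \/ holds O d v
  | SgBall t c => forall y, y < teval v t -> holds O c (scons y v)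
  | SgEx c => exists y, holds O c (scons y v)
  end.

Fixpoint sgsubst (s : nat -> term) (c : sigma) : sigma :=
  match c with
  | SgEq a b => SgEq (tsubst s a) (tsubst s b)
  | SgLt a b => SgLt (tsubst s a) (tsubst s b)
  | SgIn a => SgIn (tsubst s a)
  | SgNotin a => SgNotin (tsubst s a)
  | SgAnd c d => SgAnd (sgsubst s c) (sgsubst s d)
  | SgOr c d => SgOr (sgsubst s c) (sgsubst s d)
  | SgBall t c => SgBall (tsubst s t) (sgsubst (nup s) c)
  | SgEx c => SgEx (sgsubst (nup s) c)
  end.

Lemma holds_subst O c : forall s v,
  holds O (sgsubst s c) v <-> holds O c (fun n => teval v (s n)).
Proof.
  induction c as [a b|a b|a|a|c IHc d IHd|c IHc d IHd|t c IHc|c IHc];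
    intros s v; simpl; rewrite ?teval_subst; try tauto.
  - rewrite IHc, IHd. tauto.
  - rewrite IHc, IHd. tauto.
  - split; intros H y Hy; specialize (H y Hy); [rewrite IHc, teval_nup in H|
      rewrite IHc, teval_nup]; exact H.
  - split; intros [y H]; exists y; [rewrite IHc, teval_nup in H|
      rewrite IHc, teval_nup]; exact H.
Qed.

(** Monotonicity lets a sum of finitely many bounds serve for all of them; this yields a uniform
    oracle use under a bounded quantifier. *)
Lemma bounded_choice (P : nat -> nat -> Prop) k :
  (forall y m m', m <= m' -> P y m -> P y m') ->
  (forall y, y < k -> exists m, P y m) -> exists m, forall y, y < k -> P y m.
Proof.
  intros mono. induction k as [|k IH]; intros H.
  - exists 0. intros y Hy. lia.
  - destruct IH as [m Hm]; [intros y Hy; apply H; lia|].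
    destruct (H k) as [m' Hm']; [lia|]. exists (m + m'). intros y Hy.
    destruct (Nat.eq_dec y k) as [->|].
    + apply (mono k m'); [lia|assumption].
    + apply (mono y m); [lia|]. apply Hm. lia.
Qed.

(** Truth rests on finitely many oracle answers: an atom asks at most one question, a bounded
    quantifier combines finitely many uses, and an existential one needs a single witness. *)
Lemma holds_use O c : forall v, holds O c v ->
  exists m, forall O', (forall k, k < m -> (O k <-> O' k)) -> holds O' c v.
Proof.
  induction c as [a b|a b|a|a|c IHc d IHd|c IHc d IHd|t c IHc|c IHc];
    intros v H; simpl in *.
  - exists 0; auto.
  - exists 0; auto.
  - exists (S (teval v a)). intros O' E. apply E; [lia|assumption].
  - exists (S (teval v a)). intros O' E. rewrite <- E; [assumption|lia].
  - destruct H as [Hc Hd]. destruct (IHc v Hc) as [m Hm], (IHd v Hd) as [m' Hm'].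
    exists (m + m'). intros O' E. split; [apply Hm|apply Hm']; intros; apply E; lia.
  - destruct H as [H|H]; [destruct (IHc v H) as [m Hm]|destruct (IHd v H) as [m Hm]];
      exists m; auto.
  - destruct (bounded_choice
      (fun y m => forall O', (forall k, k < m -> (O k <-> O' k)) -> holds O' c (scons y v))
      (teval v t)) as [m Hm].
    + intros y m m' L Hm O' E. apply Hm. intros; apply E; lia.
    + auto.
    + exists m. intros O' E y Hy. apply Hm; auto.
  - destruct H as [y H]. destruct (IHc _ H) as [m Hm]. exists m. eauto.
Qed.

(** * Injective numbering of Sigma_1 formulas *)

Definition tag (n k : nat) : nat := to_nat (n, k).
Definition tag2 (n k l : nat) : nat := tag n (to_nat (k, l)).

Lemma tag_inj n k n' k' : tag n k = tag n' k' -> n = n' /\ k = k'.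
Proof. unfold tag. intros H. apply to_nat_inj in H. injection H; auto. Qed.

Lemma tag2_inj n k l n' k' l' : tag2 n k l = tag2 n' k' l' -> n = n' /\ k = k' /\ l = l'.
Proof.
  intros H. apply tag_inj in H. destruct H as [-> H].
  apply to_nat_inj in H. injection H; auto.
Qed.

Fixpoint term_code (t : term) : nat :=
  match t with
  | Var n => tag2 0 n 0
  | Zero => tag2 1 0 0
  | One => tag2 2 0 0
  | TAdd a b => tag2 3 (term_code a) (term_code b)
  | TMul a b => tag2 4 (term_code a) (term_code b)
  end.

(** The codes serve only as indices of the requirements, so injectivity suffices. *)
Fixpoint sigma_code (c : sigma) : nat :=
  match c with
  | SgEq a b => tag2 0 (term_code a) (term_code b)
  | SgLt a b => tag2 1 (term_code a) (term_code b)
  | SgIn a => tag2 2 (term_code a) 0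
  | SgNotin a => tag2 3 (term_code a) 0
  | SgAnd c d => tag2 4 (sigma_code c) (sigma_code d)
  | SgOr c d => tag2 5 (sigma_code c) (sigma_code d)
  | SgBall t c => tag2 6 (term_code t) (sigma_code c)
  | SgEx c => tag2 7 (sigma_code c) 0
  end.

Lemma term_code_inj s : forall t, term_code s = term_code t -> s = t.
Proof.
  induction s; intros [] H; apply tag2_inj in H; destruct H as (E & H & K);
    try discriminate E; f_equal; auto.
Qed.

Lemma sigma_code_inj c : forall d, sigma_code c = sigma_code d -> c = d.
Proof.
  induction c; intros [] H; apply tag2_inj in H; destruct H as (E & H & K);
    try discriminate E; f_equal; auto using term_code_inj.
Qed.

(** * Closure properties of Sigma_1 definability *)

Definition definable (O : nat -> Prop) (A : (nat -> nat) -> Prop) : Prop :=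
  exists c, forall v, A v <-> holds O c v.

Definition delta (O X : nat -> Prop) : Prop :=
  definable O (fun v => X (v 0)) /\ definable O (fun v => ~ X (v 0)).

Lemma definable_iff O A B :
  (forall v, A v <-> B v) -> definable O A -> definable O B.
Proof. intros H [c Hc]. exists c. intros v. rewrite <- H. apply Hc. Qed.

Lemma definable_eq O s t : definable O (fun v => teval v s = teval v t).
Proof. exists (SgEq s t). reflexivity. Qed.

Lemma definable_lt O s t : definable O (fun v => teval v s < teval v t).
Proof. exists (SgLt s t). reflexivity. Qed.

Lemma definable_and O A B :
  definable O A -> definable O B -> definable O (fun v => A v /\ B v).
Proof. intros [c Hc] [d Hd]. exists (SgAnd c d). intros v. simpl. rewrite Hc, Hd. tauto. Qed.

Lemma definable_or O A B :
  definable O A -> definable O B -> definable O (fun v => A v \/ B v).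
Proof. intros [c Hc] [d Hd]. exists (SgOr c d). intros v. simpl. rewrite Hc, Hd. tauto. Qed.

Lemma definable_ball O t A :
  definable O A -> definable O (fun v => forall y, y < teval v t -> A (scons y v)).
Proof.
  intros [c Hc]. exists (SgBall t c). intros v. simpl.
  split; intros H y Hy; apply Hc; auto.
Qed.

Lemma definable_ex O A :
  definable O A -> definable O (fun v => exists y, A (scons y v)).
Proof.
  intros [c Hc]. exists (SgEx c). intros v. simpl.
  split; intros [y H]; exists y; apply Hc; auto.
Qed.

Lemma definable_bex O t A :
  definable O A -> definable O (fun v => exists y, y < teval v t /\ A (scons y v)).
Proof.
  intros H. apply (definable_iff O (fun v =>
    exists y, teval (scons y v) (Var 0) < teval (scons y v) (tshift t) /\ A (scons y v))).
  - intros v. split; intros [y Hy]; exists y; rewrite teval_shift in *; exact Hy.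
  - apply (definable_ex O (fun v => teval v (Var 0) < teval v (tshift t) /\ A v)).
    apply definable_and; [apply definable_lt|exact H].
Qed.

(** Replacing every variable by [t] is harmless, because [X (v 0)] depends on variable [0] alone. *)
Lemma definable_term O (X : nat -> Prop) t :
  definable O (fun v => X (v 0)) -> definable O (fun v => X (teval v t)).
Proof.
  intros [c Hc]. exists (sgsubst (fun _ => t) c). intros v.
  rewrite holds_subst. exact (Hc (fun _ => teval v t)).
Qed.

Fixpoint numeral (n : nat) : term :=
  match n with 0 => Zero | S n => TAdd (numeral n) One end.

Lemma teval_numeral v n : teval v (numeral n) = n.
Proof. induction n; simpl; lia. Qed.

(** Number parameters are eliminated by substituting numerals for them. *)
Lemma definable_parameters O A w :
  definable O A -> definable O (fun v => A (scons (v 0) w)).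
Proof.
  intros [c Hc]. exists (sgsubst (scons (Var 0) (fun n => numeral (w n))) c). intros v.
  rewrite holds_subst, teval_scons, Hc.
  replace (fun n => teval v (numeral (w n))) with w; [reflexivity|].
  apply functional_extensionality. intros n. symmetry. apply teval_numeral.
Qed.

(** * Omega-models *)

Section Semantics.

Variable M : (nat -> Prop) -> Prop.

Fixpoint sat (v : nat -> nat) (w : nat -> nat -> Prop) (f : form) : Prop :=
  match f with
  | Eq a b => teval v a = teval v b
  | Lt a b => teval v a < teval v b
  | Mem a X => w X (teval v a)
  | Bot => False
  | Imp f g => sat v w f -> sat v w g
  | And f g => sat v w f /\ sat v w g
  | Or f g => sat v w f \/ sat v w g
  | NAll f => forall y, sat (scons y v) w f
  | NEx f => exists y, sat (scons y v) w f
  | SAll f => forall X, M X -> sat v (scons X w) f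
  | SEx f => exists X, M X /\ sat v (scons X w) f
  end.

Lemma sat_subst f : forall v w s r,
  sat v w (fsubst s r f) <-> sat (fun n => teval v (s n)) (fun X => w (r X)) f.
Proof.
  assert (up : forall X w r, (fun Y => scons X w (sup r Y)) =
                             scons X (fun Y : nat => w (r Y) : nat -> Prop)).
  { intros X w r. apply functional_extensionality; intros [|Y]; reflexivity. }
  induction f as [a b|a b|a X| |f IHf g IHg|f IHf g IHg|f IHf g IHg|f IHf|f IHf|f IHf|f IHf];
    intros v w s r; simpl; rewrite ?teval_subst; try tauto.
  - rewrite IHf, IHg. tauto.
  - rewrite IHf, IHg. tauto.
  - rewrite IHf, IHg. tauto.
  - split; intros H y; specialize (H y); [rewrite IHf, teval_nup in H|
      rewrite IHf, teval_nup]; exact H.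
  - split; intros [y H]; exists y; [rewrite IHf, teval_nup in H|
      rewrite IHf, teval_nup]; exact H.
  - split; intros H X HX; specialize (H X HX); [rewrite IHf, up in H|
      rewrite IHf, up]; exact H.
  - split; intros [X [HX H]]; exists X; (split; [exact HX|]);
      [rewrite IHf, up in H|rewrite IHf, up]; exact H.
Qed.

Lemma sat_ninst v w t f : sat v w (ninst t f) <-> sat (scons (teval v t) v) w f.
Proof. unfold ninst. rewrite sat_subst, teval_scons. reflexivity. Qed.

Lemma sat_nshift y v w f : sat (scons y v) w (nshift f) <-> sat v w f.
Proof. exact (sat_subst f (scons y v) w _ _). Qed.

Lemma sat_sinst v w X f : sat v w (sinst X f) <-> sat v (scons (w X) w) f.
Proof.
  unfold sinst. rewrite sat_subst.
  replace (fun Y => w (scons X (fun Z => Z) Y)) with (scons (w X) w); [reflexivity|].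
  apply functional_extensionality; intros [|Y]; reflexivity.
Qed.

Lemma sat_sshift v X w f : sat v (scons X w) (sshift f) <-> sat v w f.
Proof. exact (sat_subst f v (scons X w) _ _). Qed.

Lemma scons_in_model X (w : nat -> nat -> Prop) :
  M X -> (forall Y, M (w Y)) -> forall Y, M (scons X w Y).
Proof. intros HX Hw [|Y]; simpl; auto. Qed.

(** Sets are instantiated by variables only, so the set quantifier rules never leave [M] once the
    valuation lies in it. *)
Lemma soundness G f : prv G f ->
  forall v w, (forall X, M (w X)) -> (forall a, In a G -> sat v w a) -> sat v w f.
Proof.
  assert (nctx : forall G v w y, (forall a, In a G -> sat v w a) ->
            forall a, In a (map nshift G) -> sat (scons y v) w a).
  { intros G0 v w y H a Ha. apply in_map_iff in Ha. destruct Ha as (b & <- & Hb).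
    apply sat_nshift. auto. }
  assert (sctx : forall G v w X, (forall a, In a G -> sat v w a) ->
            forall a, In a (map sshift G) -> sat v (scons X w) a).
  { intros G0 v w X H a Ha. apply in_map_iff in Ha. destruct Ha as (b & <- & Hb).
    apply sat_sshift. auto. }
  assert (cctx : forall G v w b, sat v w b -> (forall a, In a G -> sat v w a) ->
            forall a, In a (b :: G) -> sat v w a).
  { intros G0 v w b Hb H a [<-|Ha]; auto. }
  induction 1 as
    [G f Hf|G f g _ IH|G f g _ IH1 _ IH2|G f g _ IH1 _ IH2|G f g _ IH|G f g _ IH
    |G f g _ IH|G f g _ IH|G f g h _ IH1 _ IH2 _ IH3|G f _ IH|G f _ IH|G f t _ IH
    |G f t _ IH|G f g _ IH1 _ IH2|G f _ IH|G f X _ IH|G f X _ IH|G f g _ IH1 _ IH2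
    |G t|G s t f _ IH1 _ IH2]; intros v w Hw HG; simpl sat in *.
  - exact (HG f Hf).
  - intros Hf. apply (IH v w Hw). apply cctx; assumption.
  - apply (IH1 v w Hw HG). apply (IH2 v w Hw HG).
  - split; [apply IH1|apply IH2]; assumption.
  - apply (IH v w Hw HG).
  - apply (IH v w Hw HG).
  - left. apply IH; assumption.
  - right. apply IH; assumption.
  - destruct (IH1 v w Hw HG);
      [apply (IH2 v w Hw)|apply (IH3 v w Hw)]; apply cctx; assumption.
  - apply NNPP. intros Hn. apply (IH v w Hw). apply cctx; assumption.
  - intros y. apply IH; [assumption|]. apply nctx; assumption.
  - apply sat_ninst. apply (IH v w Hw HG).
  - exists (teval v t). apply sat_ninst. apply IH; assumption.
  - destruct (IH1 v w Hw HG) as [y Hy]. apply (sat_nshift y).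
    apply IH2; [assumption|]. apply cctx; [assumption|]. apply nctx; assumption.
  - intros X HX. apply IH; [apply scons_in_model; assumption|]. apply sctx; assumption.
  - apply sat_sinst. apply (IH v w Hw HG). apply Hw.
  - exists (w X). split; [apply Hw|]. apply sat_sinst. apply IH; assumption.
  - destruct (IH1 v w Hw HG) as [X [HX H]]. apply (sat_sshift v X).
    apply IH2; [apply scons_in_model; assumption|].
    apply cctx; [assumption|]. apply sctx; assumption.
  - reflexivity.
  - apply sat_ninst. rewrite <- (IH1 v w Hw HG). apply sat_ninst. apply IH2; assumption.
Qed.

Lemma sat_closure f :
  (forall v w, (forall X, M (w X)) -> sat v w f) ->
  forall v w, (forall X, M (w X)) -> sat v w (closure f).
Proof.
  intros H. unfold closure.
  assert (K : forall n v w, (forall X, M (w X)) -> sat v w (Nat.iter n NAll f)).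
  { induction n as [|n IH]; intros v w Hw; simpl; auto. }
  induction (sbound f) as [|n IH]; intros v w Hw; simpl; auto using scons_in_model.
Qed.

End Semantics.

(** * The Delta_1 sets of an oracle form a model of RCA_0 *)

Section DeltaModel.

Variable O : nat -> Prop.

(** A formula and its negation are treated together: [sigma] negates only atoms, while an
    implication needs its negated premise. At set atoms both halves come from the Delta_1
    parameters. *)
Lemma bounded_definable M f w : bounded f -> (forall X, delta O (w X)) ->
  definable O (fun v => sat M v w f) /\ definable O (fun v => ~ sat M v w f).
Proof.
  intros Hf Hw.
  induction Hf as [s t|s t|t X| |f g _ [F F'] _ [G G']|f g _ [F F'] _ [G G']
                  |f g _ [F F'] _ [G G']|t f _ [F F']|t f _ [F F']]; simpl; split.
  - apply definable_eq.
  - apply (definable_iff O (fun v => teval v s < teval v t \/ teval v t < teval v s)).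
    + intros v. lia.
    + apply definable_or; apply definable_lt.
  - apply definable_lt.
  - apply (definable_iff O (fun v => teval v t < teval v s \/ teval v s = teval v t)).
    + intros v. lia.
    + apply definable_or; [apply definable_lt|apply definable_eq].
  - apply definable_term, Hw.
  - apply (definable_term O (fun n => ~ w X n)), Hw.
  - exists (SgLt Zero Zero). intros v. simpl. lia.
  - exists (SgEq Zero Zero). intros v. simpl. tauto.
  - eapply definable_iff; [|exact (definable_or _ _ _ F' G)]. intros v. simpl. tauto.
  - eapply definable_iff; [|exact (definable_and _ _ _ F G')]. intros v. simpl. tauto.
  - exact (definable_and _ _ _ F G).
  - eapply definable_iff; [|exact (definable_or _ _ _ F' G')]. intros v. simpl. tauto.
  - exact (definable_or _ _ _ F G).
  - eapply definable_iff; [|exact (definable_and _ _ _ F' G')]. intros v. simpl. tauto.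
  - eapply definable_iff; [|exact (definable_ball _ t _ F)]. intros v. simpl.
    split; intros H y Hy; apply H; rewrite teval_shift in *; exact Hy.
  - eapply definable_iff; [|exact (definable_bex _ t _ F')]. intros v. simpl. split.
    + intros (y & Hy & N) H. apply N, H. rewrite teval_shift. exact Hy.
    + intros H. apply not_all_ex_not in H. destruct H as [y H].
      apply imply_to_and in H. rewrite teval_shift in H. eauto.
  - eapply definable_iff; [|exact (definable_bex _ t _ F)]. intros v. simpl.
    split; intros [y H]; exists y; rewrite teval_shift in *; exact H.
  - eapply definable_iff; [|exact (definable_ball _ t _ F')]. intros v. simpl. split.
    + intros H [y [Hy K]]. rewrite teval_shift in Hy. exact (H y Hy K).
    + intros H y Hy K. apply H. exists y. rewrite teval_shift. auto.
Qed.

Lemma bounded_delta M f v w : bounded f -> (forall X, delta O (w X)) ->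
  delta O (fun n => sat M (scons n v) w f).
Proof.
  intros Hf Hw. destruct (bounded_definable M f w Hf Hw) as [F F'].
  split; [exact (definable_parameters O _ v F)|exact (definable_parameters O _ v F')].
Qed.

(** The set is Sigma_1 by [f]; its complement is Sigma_1 because lying outside means having a
    counterexample to [g]. *)
Lemma delta_comprehension_sound f g v w :
  Sigma01 f -> Pi01 g -> (forall X, delta O (w X)) ->
  sat (delta O) v w (delta_comprehension f g).
Proof.
  intros [f' Hf] [g' Hg] Hw E.
  exists (fun n => sat (delta O) (scons n v) w (NEx f')).
  split.
  - split.
    + apply (definable_parameters O (fun u => sat (delta O) u w (NEx f')) v).
      apply (definable_ex O (fun u => sat (delta O) u w f')).
      apply bounded_definable; assumption.
    + apply (definable_iff O (fun u => exists y, ~ sat (delta O) (scons y (scons (u 0) v)) w g')).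
      * intros u. split.
        -- intros [y Hy] H. apply Hy. apply (proj1 (E (u 0)) H).
        -- intros H. apply not_all_ex_not. intros K. apply H. exact (proj2 (E (u 0)) K).
      * apply (definable_parameters O
          (fun u => exists y, ~ sat (delta O) (scons y u) w g') v).
        apply (definable_ex O (fun u => ~ sat (delta O) u w g')).
        apply bounded_definable; assumption.
  - intros n. split; intros H.
    + apply sat_sshift. exact H.
    + apply sat_sshift in H. exact H.
Qed.

Lemma RCA0_sound f v w : RCA0 f -> (forall X, delta O (w X)) -> sat (delta O) v w f.
Proof.
  intros Hf Hw. destruct Hf as [f Hf|f Hf|f g Hf Hg]; apply sat_closure; auto;
    clear v w Hw; intros v w Hw.
  - simpl in Hf. repeat (destruct Hf as [<-|Hf]; [simpl; lia|]). destruct Hf.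
  (* The numbers of the model are standard, so induction on [nat] applies. *)
  - intros [H0 HS] y. apply sat_ninst in H0. induction y as [|y IH]; [exact H0|].
    specialize (HS y IH). apply sat_subst in HS.
    rewrite teval_scons in HS. simpl in HS. rewrite Nat.add_1_r in HS. exact HS.
  - apply delta_comprehension_sound; assumption.
Qed.

End DeltaModel.

(** * The counterexample *)

Definition pair_code (x y : nat) : nat := (x + y) * (x + y) + x.

(** With [s = x + y] the code lies in [[s^2, (s+1)^2)], which determines [s] and then [x]. *)
Lemma pair_code_inj x y x' y' : pair_code x y = pair_code x' y' -> x = x' /\ y = y'.
Proof.
  unfold pair_code. intros H.
  assert (x + y = x' + y'); [|nia].
  destruct (Nat.lt_trichotomy (x + y) (x' + y')) as [L|[L|L]]; [nia|exact L|nia].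
Qed.

Lemma pair_code_ge x y : x <= pair_code x y /\ y <= pair_code x y.
Proof. unfold pair_code. split; nia. Qed.

Definition graph (R : rel) (k : nat) : Prop := exists x y, k = pair_code x y /\ R x y.

Lemma graph_pair R x y : graph R (pair_code x y) <-> R x y.
Proof.
  split.
  - intros (x' & y' & E & H). apply pair_code_inj in E. destruct E as [-> ->]. exact H.
  - intros H. exists x, y. auto.
Qed.

(** A code bounds both components, so a finite use of the graph is a finite use of the relation;
    this makes Sigma_1 facts open. *)
Lemma graph_agree m R R' : agree m R R' -> forall k, k < m -> (graph R k <-> graph R' k).
Proof.
  intros A k Hk. split; intros (x & y & -> & H); exists x, y; (split; [reflexivity|]);
    destruct (pair_code_ge x y); apply (A x y); (assumption || lia).
Qed.

Lemma delta_oracle O : delta O O.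
Proof. split; [exists (SgIn (Var 0))|exists (SgNotin (Var 0))]; reflexivity. Qed.

(** A requirement is a pair of formulas, read as definitions of a set and of its complement. For a
    Delta_1 set every [x] satisfies one of the two, which excludes the undecided outcome of
    [generic_order]. *)
Lemma generic_delta_order :
  exists R, even_antichain_order R /\
    forall I, delta (graph R) I -> exists x N, x < N /\
      ((I x /\ forall z, N <= z -> R z x) \/ (~ I x /\ forall z, N <= z -> R x z)).
Proof.
  (* The definition of a Delta_1 set depends on variable [0] only, so the constant valuation [x]
     serves. *)
  set (A := fun e x R => exists c d,
    to_nat (sigma_code c, sigma_code d) = e /\ holds (graph R) c (fun _ => x)).
  set (B := fun e x R => exists c d,
    to_nat (sigma_code c, sigma_code d) = e /\ holds (graph R) d (fun _ => x)).
  destruct (generic_order A B) as (R & G & H).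
  - intros e x R (c & d & E & H). destruct (holds_use _ _ _ H) as [m Hm].
    exists m. intros R' HR. exists c, d. split; [exact E|]. apply Hm, graph_agree, HR.
  - intros e x R (c & d & E & H). destruct (holds_use _ _ _ H) as [m Hm].
    exists m. intros R' HR. exists c, d. split; [exact E|]. apply Hm, graph_agree, HR.
  - exists R. split; [exact G|]. intros I [[c Hc] [d Hd]].
    destruct (H (to_nat (sigma_code c, sigma_code d))) as (x & N & L & K).
    exists x, N. split; [exact L|].
    assert (HA : A (to_nat (sigma_code c, sigma_code d)) x R <-> I x).
    { rewrite (Hc (fun _ => x)). split.
      - intros (c' & d' & E & H'). apply to_nat_inj in E. injection E as E _.
        apply sigma_code_inj in E. subst c'. exact H'.
      - intros H'. exists c, d. auto. }
    assert (HB : B (to_nat (sigma_code c, sigma_code d)) x R <-> ~ I x).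
    { rewrite (Hd (fun _ => x)). split.
      - intros (c' & d' & E & H'). apply to_nat_inj in E. injection E as _ E.
        apply sigma_code_inj in E. subst d'. exact H'.
      - intros H'. exists c, d. auto. }
    rewrite HA, HB in K. tauto.
Qed.

(** If [x] is in [I], its principal ideal covers everything from [N] on; otherwise [I] has no member
    there, since such a member would put [x] in [I]. Hence the principal ideals of the members below
    [N] suffice. *)
Lemma finite_union_sound (R : rel) (I : nat -> Prop) x N v w :
  even_antichain_order R -> delta (graph R) I ->
  (forall a b, R a b -> I b -> I a) -> x < N ->
  ((I x /\ forall z, N <= z -> R z x) \/ (~ I x /\ forall z, N <= z -> R x z)) ->
  (forall X, delta (graph R) (w X)) -> w 0 = I -> w 1 = graph R ->
  (forall n, w 2 n) ->
  sat (delta (graph R)) v w (finite_union_of_ideals 2 1 0).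
Proof.
  intros G DI down L K Hw E0 E1 E2.
  exists N.
  (* The [i]-th ideal is the principal ideal of [i] if [i] is in [I], and is
     empty otherwise. *)
  set (f := bex (TAdd (Var 0) One) (bex (TAdd (Var 1) One)
    (And (Eq (Var 2) (code (Var 1) (Var 0))) (And (Lt (Var 0) (Var 3))
      (And (Mem (Var 0) 0) (Mem (Var 2) 1)))))).
  (* Variable [3] in the matrix of [f] is [N]. Both components are sought up to the code itself,
     which keeps [f] bounded and so [Z] Delta_1. *)
  set (Z := fun n => sat (delta (graph R)) (scons n (fun _ => N)) w f).
  assert (DZ : delta (graph R) Z).
  { apply bounded_delta; [|exact Hw]. unfold f. repeat constructor. }
  assert (HZ : forall y i, Z (pair_code y i) <-> i < N /\ I i /\ R y i).
  { intros y i. unfold Z, f. simpl. rewrite E0, E1. split.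
    - intros (y' & _ & i' & _ & E & Hi & HI & HR).
      apply pair_code_inj in E. destruct E as [<- <-].
      apply graph_pair in HR. auto.
    - intros (Hi & HI & HR). destruct (pair_code_ge y i).
      exists y. split; [lia|]. exists i. split; [lia|].
      split; [reflexivity|]. split; [exact Hi|]. split; [exact HI|].
      apply graph_pair, HR. }
  exists Z. split; [exact DZ|]. split.
  - intros i Hi. simpl in Hi.
    exists (fun y => Z (pair_code y i)). split; [|split].
    + apply (bounded_delta (graph R) (delta (graph R)) (Mem (code (Var 0) (Var 1)) 0)
        (fun _ => i) (fun _ => Z)); [constructor|auto].
    + intros y. simpl. tauto.
    + simpl. rewrite E1. split; [split|].
      * intros y _. apply E2.
      * intros a b Hab Hb. apply graph_pair in Hab. apply HZ in Hb. apply HZ.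
        repeat split; try tauto. destruct Hb as (_ & _ & Hb).
        exact (po_trans _ G _ _ _ Hab Hb).
      (* The generator [i] is an upper bound of any two members of its section. *)
      * intros a b Ha Hb. apply HZ in Ha, Hb. exists i.
        split; [|split].
        -- apply HZ. repeat split; try tauto. apply (po_refl _ G).
        -- apply graph_pair. tauto.
        -- apply graph_pair. tauto.
  - intros y. simpl. rewrite E0. split.
    + intros Hy. destruct (le_lt_dec N y) as [Ny|Ny].
      * destruct K as [[Hx K]|[Hx K]].
        -- exists x. split; [exact L|]. apply HZ. auto.
        -- destruct Hx. exact (down _ _ (K y Ny) Hy).
      * exists y. split; [exact Ny|]. apply HZ. repeat split; auto. apply (po_refl _ G).
    + intros (i & Hi & H). apply HZ in H. apply (down y i); tauto.
Qed.

Theorem theorem5p12 :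
  ~ proves RCA0 finite_unions_imply_no_infinite_antichain.
Proof.
  intros (G & HG & D).
  destruct generic_delta_order as (R & PO & HR).
  set (w := fun _ : nat => graph R).
  assert (Hw : forall X, delta (graph R) (w X)) by (intros; apply delta_oracle).
  assert (T := soundness (delta (graph R)) G _ D (fun _ => 0) w Hw
    (fun a Ha => RCA0_sound _ a _ _ (HG a Ha) Hw)).
  (* The underlying set of the order is all of [nat]. *)
  assert (DP : delta (graph R) (fun n => n = n)).
  { apply (bounded_delta (graph R) (delta (graph R)) (Eq (Var 0) (Var 0)) (fun _ => 0) w);
      [constructor|exact Hw]. }
  refine (T (fun n => n = n) DP (graph R) (delta_oracle _) _ _).
  - split.
    + simpl. split; [|split; [|split]].
      * intros k (x & y & -> & _). exists x, y. repeat split.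
      * intros x _. apply graph_pair, PO.
      * intros x y H K. apply graph_pair in H, K. exact (po_antisym _ PO _ _ H K).
      * intros x y z H K. apply graph_pair in H, K. apply graph_pair.
        exact (po_trans _ PO _ _ _ H K).
    + intros I DI [_ HI]. destruct (HR I DI) as (x & N & L & K).
      apply (finite_union_sound R I x N); auto.
      * intros a b H. apply (HI a b). apply graph_pair, H.
      * intros [|[|[|X]]]; auto using delta_oracle.
      * intros n. reflexivity.
  (* The antichain of even numbers is given by a bounded formula, hence belongs to the model. *)
  - exists (fun n => sat (delta (graph R)) (scons n (fun _ => 0)) w
      (bex (TAdd (Var 0) One) (Eq (Var 1) (TAdd (Var 0) (Var 0))))).
    split; [apply bounded_delta; [repeat constructor|exact Hw]|]. simpl.
    assert (ev : forall x, (exists y, y < x + 1 /\ x = y + y) -> Nat.Even x).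
    { intros x (y & _ & ->). exists y. lia. }
    split; [split|].
    + auto.
    + intros x y Hx Hy N. split; intros H; apply graph_pair in H; apply N.
      * apply (po_even _ PO); auto.
      * symmetry. apply (po_even _ PO); auto.
    + intros n. exists (S n + S n). split; [lia|]. exists (S n). lia.
Qed.
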